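(* For every number of agents $n$ and every $\alpha\in[0,1]$ with $\alpha>\frac1n$, there exist an instance with $n$ agents, a finite set $\mathcal{M}$ of goods, and two additive valuation functions $u,v:2^{\mathcal{M}}\to\mathbb{R}_{\ge0}$, giving two identical valuation profiles (in the first profile every agent has valuation $u$, in the second profile every agent has valuation $v$; either profile can be viewed as consisting of identical subjective utilities and the other as consisting of market values), such that no allocation is simultaneously $\alpha$-MMS with respect to the first profile and either EF1 or $\alpha$-MMS with respect to the second profile.
   Context: A function $f:2^{\mathcal{M}}\to\mathbb{R}_{\ge0}$ is additive if $f(S)=\sum_{g\in S}f(\{g\})$ for all $S\subseteq\mathcal{M}$, with $f(\emptyset)=0$. An allocation $A=(A_1,\dots,A_n)$ is a partition of $\mathcal{M}$ into $n$ pairwise disjoint (possibly empty) bundles with union $\mathcal{M}$, where $A_i$ is given to agent $i$. An identical valuation profile is one in which all $n$ agents have the same valuation function $f$ (different profiles may have different functions). With respect to the identical profile with valuation $f$: the maximin share of each agent is $\mu=\max_{(B_1,\dots,B_n)}\min_{k\in[n]}f(B_k)$, the maximum being over all $n$-partitions of $\mathcal{M}$ (parts may be empty); for $\alpha\in[0,1]$, $A$ is $\alpha$-MMS if $f(A_i)\ge\alpha\mu$ for every agent $i$; $A$ is EF1 if for every pair of agents $i,j$, either $A_j=\emptyset$ or $f(A_i)\ge f(A_j\setminus\{g\})$ for some $g\in A_j$. *)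

(* Defs.v *)
From HB Require Import structures.
From mathcomp Require Import all_boot all_order all_algebra reals.
Set Implicit Arguments.
Unset Strict Implicit.
Unset Printing Implicit Defensive.
Import Order.TTheory GRing.Theory Num.Theory.
Local Open Scope ring_scope.

Section FairDivision.
Variables (R : realType) (M : finType) (n : nat).

(* The empty-sum case of additivity gives f set0 = 0. *)
Definition additive_valuation (f : {set M} -> R) : Prop :=
  (forall S, 0 <= f S) /\ (forall S, f S = \sum_(g in S) f [set g]).

Definition is_allocation (A : {ffun 'I_n -> {set M}}) : bool :=
  [forall i, forall j, (i != j) ==> [disjoint A i & A j]]
  && (\bigcup_i A i == [set: M]).

(* The units f setT and 0 of the iterated min and max are neutral when f is
   an additive valuation and 0 < n: see min_bundleP and mmsP. *)
Definition min_bundle (f : {set M} -> R) (B : {ffun 'I_n -> {set M}}) : R :=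
  \big[Num.min/f [set: M]]_(k < n) f (B k).

Definition mms (f : {set M} -> R) : R :=
  \big[Num.max/0]_(B : {ffun 'I_n -> {set M}} | is_allocation B)
    min_bundle f B.

Definition identical_profile (f : {set M} -> R) : 'I_n -> {set M} -> R :=
  fun _ => f.

Definition alpha_MMS (alpha : R) (V : 'I_n -> {set M} -> R)
    (A : {ffun 'I_n -> {set M}}) : Prop :=
  forall i, alpha * mms (V i) <= V i (A i).

Definition EF1 (V : 'I_n -> {set M} -> R)
    (A : {ffun 'I_n -> {set M}}) : Prop :=
  forall i j, A j = set0 \/
    exists2 g, g \in A j & V i (A j :\ g) <= V i (A i).

Lemma additive_valuation_le (f : {set M} -> R) (S : {set M}) :
  additive_valuation f -> f S <= f [set: M].
Proof.
move=> [f0 fD]; rewrite (fD S) (fD setT) big_mkcond [leRHS]big_mkcond /=.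
by apply: ler_sum => g _; rewrite inE; case: ifP.
Qed.

Lemma min_bundleP (f : {set M} -> R) (B : {ffun 'I_n -> {set M}}) :
  additive_valuation f -> (0 < n)%N ->
  (exists k, min_bundle f B = f (B k)) /\ forall k, min_bundle f B <= f (B k).
Proof.
move=> fV n0; have le k : min_bundle f B <= f (B k) by exact: bigmin_le_cond.
split=> //.
have [k _ e] := @eq_bigmin _ _ _ (f [set: M]) (Ordinal n0) xpredT
  (fun k => f (B k)) isT (fun k _ => additive_valuation_le _ fV).
by exists k.
Qed.

Lemma mmsP (f : {set M} -> R) :
  additive_valuation f -> (0 < n)%N ->
  (exists2 B, is_allocation B & mms f = min_bundle f B) /\
  forall B, is_allocation B -> min_bundle f B <= mms f.
Proof.
move=> fV n0; split; last by move=> B AB; exact: le_bigmax_cond.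
pose B0 : {ffun 'I_n -> {set M}} :=
  [ffun i => if i == Ordinal n0 then [set: M] else set0].
have AB0 : is_allocation B0.
  apply/andP; split.
    apply/forallP => i; apply/forallP => j; apply/implyP => ij.
    rewrite !ffunE -setI_eq0; case: (i =P _) => [ei|_]; last by rewrite set0I.
    by case: (j =P _) => [ej|_]; [rewrite ei ej eqxx in ij | rewrite setI0].
  rewrite -subTset; apply/subsetP => x _; apply/bigcupP.
  by exists (Ordinal n0); rewrite // ffunE eqxx inE.
have [|B AB e] := @eq_bigmax _ _ _ 0 B0 is_allocation (min_bundle f) AB0;
  last by exists B.
move=> B _; have [[k ->] _] := min_bundleP B fV n0; exact: fV.1.
Qed.

End FairDivision.

Arguments mms {R M} n f.
Arguments identical_profile {R M} n f.

(* Main.v *)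
Require Import Defs.
From mathcomp Require Import all_boot all_order all_algebra reals.
Import Order.TTheory GRing.Theory Num.Theory.
Local Open Scope ring_scope.
Set Implicit Arguments.
Unset Strict Implicit.
Unset Printing Implicit Defensive.

(** Take [n] small goods and [n - 1] big ones. For [u] a small good is worth [1]
    and a big one [n]; bundling all the small goods shows that the maximin share
    is at least [n]. For [v] a small good is worth [1] and a big one [0], so both
    EF1 and a positive fraction of the maximin share force every agent to get a
    small good, hence exactly one. Some agent gets no big good, and her bundle
    has [u]-value [1], less than [alpha * n]. *)

Definition weight_valuation (R : realType) (M : finType) (w : M -> R)
  (S : {set M}) : R := \sum_(g in S) w g.

(** Since [o] sends each good to a single agent, disjointness and covering come for free. *)
Definition owner_allocation (M : finType) (n : nat) (o : M -> 'I_n) :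
  {ffun 'I_n -> {set M}} := [ffun i => [set g | o g == i]].

Section Valuations.
Variables (R : realType) (M : finType).

Lemma weight_valuation_additive (w : M -> R) :
  (forall g, 0 <= w g) -> additive_valuation (weight_valuation w).
Proof.
move=> w0; split=> S; first exact: sumr_ge0.
by apply: eq_bigr => g _; rewrite /weight_valuation big_set1.
Qed.

Lemma weight_le_valuation (w : M -> R) (S : {set M}) g :
  (forall h, 0 <= w h) -> g \in S -> w g <= weight_valuation w S.
Proof.
move=> w0 gS; rewrite /weight_valuation (bigD1 g) //= lerDl.
exact: sumr_ge0.
Qed.

Lemma le_mms (n : nat) (f : {set M} -> R) (B : {ffun 'I_n -> {set M}}) c :
  additive_valuation f -> (0 < n)%N -> is_allocation B ->
  (forall i, c <= f (B i)) -> c <= mms n f.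
Proof.
move=> fV n0 AB cB; have [_ /(_ B AB)] := mmsP fV n0.
by apply: le_trans; have [[k ->] _] := min_bundleP B fV n0.
Qed.

End Valuations.

Section Allocations.
Variables (M : finType) (n : nat).

Lemma owner_allocationP (o : M -> 'I_n) : is_allocation (owner_allocation o).
Proof.
apply/andP; split.
  apply/forallP => i; apply/forallP => j; apply/implyP => ij.
  rewrite disjoint_subset; apply/subsetP => g.
  by rewrite !ffunE !inE => /eqP ->.
rewrite -subTset; apply/subsetP => g _; apply/bigcupP.
by exists (o g); rewrite // ffunE inE.
Qed.

(** Covering provides an owner of each good and disjointness makes it unique. Counting goods in
    bundles thus becomes a question about maps between finite types. *)
Lemma allocation_owner (A : {ffun 'I_n -> {set M}}) :
  is_allocation A -> exists o : M -> 'I_n, forall g i, (g \in A i) = (o g == i).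
Proof.
move=> /andP[/forallP disjA /eqP covA].
have ex g : exists i, g \in A i.
  by have /bigcupP[i _] : g \in \bigcup_i A i; [rewrite covA inE | exists i].
exists (fun g => xchoose (ex g)) => g i; have gA := xchooseP (ex g).
apply/idP/eqP => [gi|<- //]; apply/eqP/negPn/negP => ne.
have := forallP (disjA (xchoose (ex g))) i; rewrite ne => dA.
by have := disjointFr dA gA; rewrite gi.
Qed.

End Allocations.

Section Instance.
Variables (R : realType) (n : nat).

(* [inl] injects the small goods, [inr] the big ones. *)
Definition good : finType := ('I_n + 'I_n.-1)%type.

Definition u_weight (g : good) : R := if g is inl _ then 1 else n%:R.
Definition v_weight (g : good) : R := if g is inl _ then 1 else 0.

Definition u_val := weight_valuation u_weight.
Definition v_val := weight_valuation v_weight.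

Lemma u_weight_ge0 g : 0 <= u_weight g.
Proof. by case: g => i; rewrite /u_weight ?ler01 ?ler0n. Qed.

Lemma v_weight_ge0 g : 0 <= v_weight g.
Proof. by case: g => i; rewrite /v_weight ?ler01. Qed.

Lemma u_val_additive : additive_valuation u_val.
Proof. exact/weight_valuation_additive/u_weight_ge0. Qed.

Lemma v_val_additive : additive_valuation v_val.
Proof. exact/weight_valuation_additive/v_weight_ge0. Qed.

Lemma v_val_eq0 (S : {set good}) :
  (forall i, inl i \notin S) -> v_val S = 0.
Proof. by move=> noS; apply: big1 => -[i|//]; rewrite (negbTE (noS i)). Qed.

Lemma v_val_ge1 (S : {set good}) i : inl i \in S -> 1 <= v_val S.
Proof. exact: (@weight_le_valuation _ _ _ _ (inl i) v_weight_ge0). Qed.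

Hypothesis n_gt0 : (0 < n)%N.

(** Witness: agent [last] takes all [n] small goods, every other agent one big good. *)
Lemma mms_u_ge : n%:R <= mms n u_val.
Proof.
(* [last] has index [n.-1], the only one outside the image of [widen_ord]. *)
pose last := Ordinal (etrans (congr1 (fun k => k <= n)%N (prednK n_gt0)) (leqnn n)).
pose o (g : good) := if g is inr j then widen_ord (leq_pred n) j else last.
apply: (le_mms (B := owner_allocation o)) u_val_additive n_gt0 _ _.
  exact: owner_allocationP.
move=> i; rewrite ffunE; have [ilt|ige] := ltnP i n.-1.
  apply: (@weight_le_valuation _ _ _ _ (inr (Ordinal ilt)) u_weight_ge0).
  by rewrite inE; apply/eqP/val_inj.
have ilast : last = i.
  by apply/val_inj/eqP; rewrite eqn_leq ige -ltnS prednK ?ltn_ord.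
rewrite /u_val /weight_valuation big_sumType /= [X in X + _](eq_bigl xpredT).
  by rewrite sumr_const card_ord lerDl; apply: sumr_ge0 => *; rewrite ler0n.
by move=> j; rewrite inE /= ilast eqxx.
Qed.

(** Witness: one small good per agent. The big goods are worthless for [v_val], so they may all go
    to agent 0. *)
Lemma mms_v_ge : 1 <= mms n v_val.
Proof.
pose o (g : good) := if g is inl i then i else Ordinal n_gt0.
apply: (le_mms (B := owner_allocation o)) v_val_additive n_gt0 _ _.
  exact: owner_allocationP.
by move=> i; apply: (@v_val_ge1 _ i); rewrite ffunE inE.
Qed.

(** A bundle without small goods has [v_val] equal to 0, whereas [alpha] times the maximin share is
    positive. *)
Lemma alpha_MMS_v_small alpha (A : {ffun 'I_n -> {set good}}) :
  0 < alpha -> alpha_MMS alpha (identical_profile n v_val) A ->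
  forall i, exists j, inl j \in A i.
Proof.
move=> alpha0 mmsA i; apply/existsP; apply: contraT => /existsPn noA.
have := mmsA i; rewrite /identical_profile v_val_eq0 // leNgt => /negP[].
by rewrite mulr_gt0 // (lt_le_trans ltr01) ?mms_v_ge.
Qed.

(* If agent [i] had no small good, pigeonhole would give two to some agent [j],
   and removing any single good would leave one of them. *)
Lemma EF1_v_small (A : {ffun 'I_n -> {set good}}) :
  is_allocation A -> EF1 (identical_profile n v_val) A ->
  forall i, exists j, inl j \in A i.
Proof.
move=> /allocation_owner[o oA] efA i.
apply/existsP; apply: contraT => /existsPn noA.
(* An injective self-map of ['I_n] is onto, so [i] would own the small good [h i]. *)
suff /injF_bij[h _ hK] : injective (fun j => o (inl j)).
  by have := noA (h i); rewrite oA hK eqxx.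
move=> a b oab; apply/eqP/negPn/negP => ab.
have aA : inl a \in A (o (inl a)) by rewrite oA.
have bA : inl b \in A (o (inl a)) by rewrite oA oab.
case: (efA i (o (inl a))) => [A0|[g _]]; first by rewrite A0 inE in aA.
rewrite /identical_profile (v_val_eq0 noA) leNgt => /negP[].
apply: (lt_le_trans ltr01); have [ga|ga] := eqVneq (inl a) g.
  apply: (@v_val_ge1 _ b); rewrite !inE bA andbT -ga.
  by apply: contra_neq ab => -[].
by apply: (@v_val_ge1 _ a); rewrite !inE aA ga.
Qed.

Lemma exists_u_val_le1 (A : {ffun 'I_n -> {set good}}) :
  is_allocation A -> (forall i, exists j, inl j \in A i) ->
  exists i, u_val (A i) <= 1.
Proof.
move=> /allocation_owner[o oA] small.
pose s i := xchoose (small i).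
have os i : o (inl (s i)) = i.
  by apply/eqP; rewrite -oA; exact: (xchooseP (small i)).
(* The injection [s] of ['I_n] into itself is a bijection, so [s i] is the only small good of agent
   [i]. *)
have [t tK sK] := injF_bij (can_inj (g := fun j => o (inl j)) os).
have [i /forallP noA] : exists i, [forall j, o (inr j) != i].
  apply/existsP; apply: contraT => /existsPn big.
  have ex i : exists j, o (inr j) == i.
    by have /forallPn[j] := big i; rewrite negbK; exists j.
  have ek i : o (inr (xchoose (ex i))) = i by apply/eqP/(xchooseP (ex i)).
  (* Choosing a big good for each agent would inject ['I_n] into ['I_n.-1]. *)
  have := leq_card _ (can_inj (g := fun j => o (inr j)) ek).
  by rewrite !card_ord -ltnS prednK // ltnn.
exists i; rewrite /u_val /weight_valuation big_sumType /=.
rewrite [X in _ + X]big_pred0 ?addr0; last first.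
  by move=> j; rewrite oA (negbTE (noA j)).
rewrite (big_pred1 (s i)) // => j /=.
by rewrite oA -{1}(sK j) os (can2_eq sK tK).
Qed.

End Instance.

Theorem theorem6 (R : realType) (n : nat) (alpha : R) (n_gt0 : (0 < n)%N)
    (alpha_ge0 : 0 <= alpha) (alpha_le1 : alpha <= 1)
    (alpha_gt : 1 / n%:R < alpha) :
  exists (M : finType) (u v : {set M} -> R),
    [/\ additive_valuation u,
        additive_valuation v &
        ~ exists A : {ffun 'I_n -> {set M}},
            [/\ is_allocation A,
                alpha_MMS alpha (identical_profile n u) A &
                EF1 (identical_profile n v) A \/
                alpha_MMS alpha (identical_profile n v) A]].
Proof.
have nR : 0 < n%:R :> R by rewrite ltr0n.
have alpha0 : 0 < alpha by apply: le_lt_trans alpha_gt; rewrite divr_ge0 ?ltW.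
exists (good n), (@u_val R n), (@v_val R n).
split; [exact: u_val_additive | exact: v_val_additive |].
move=> [A [allA mmsA efA]].
have small : forall i, exists j, inl j \in A i.
  by case: efA; [exact: EF1_v_small | exact: alpha_MMS_v_small].
have [i ui] := exists_u_val_le1 R n_gt0 allA small.
have := le_trans (mmsA i) ui; rewrite leNgt => /negP[].
(* The bound [1 / n%:R < alpha] gives [1 < alpha * n%:R], and the maximin share for [u_val] is at
   least [n%:R]. *)
apply: lt_le_trans (_ : alpha * n%:R <= _).
  by rewrite -ltr_pdivrMr.
by rewrite ler_pM2l // mms_u_ge.
Qed.
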